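(* Let $K\ge 2$ and $\varepsilon>0$. Then $$\mathbb{P}\left(|\tau_i-\tau_j|<\varepsilon \text{ for some } (i,j)\in\{1,\dots,K\}^2,\ i\neq j\right)$$ $$=1-\mathbb{E}\Bigg[\sum_{j\in P_K}\int_0^\infty f_{j_1}(x_1)\int_{x_1+\varepsilon}^\infty f_{j_2}(x_2)\int_{x_2+\varepsilon}^\infty f_{j_3}(x_3)\cdots\int_{x_{K-3}+\varepsilon}^\infty f_{j_{K-2}}(x_{K-2})\int_{x_{K-2}+\varepsilon}^\infty f_{j_{K-1}}(x_{K-1})$$ $$\times\exp\left[-A_{j_K}(x_{K-1}+\varepsilon)-A_0(x_{K-1}+\varepsilon)\right]dx_{K-1}\,dx_{K-2}\cdots dx_3\,dx_2\,dx_1\Bigg].$$ (The iterated integral is over $x_1\ge 0$ and $x_k\ge x_{k-1}+\varepsilon$ for $k=2,\dots,K-1$.)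
   Context: Let $(\Omega,\mathcal F,\mathbb P,\mathbb F)$ be a filtered probability space satisfying the usual conditions, carrying an $\mathbb R^d$-valued process $X=(X_t)_{t\ge 0}$ with right-continuous paths with left limits, and $K+1$ exponential random variables $Z_0,Z_1,\dots,Z_K$ of parameter $1$, independent of each other and of $X$. For $i=0,1,\dots,K$ let $\alpha_i:\mathbb R^d\to[0,\infty)$ be a non-random, positive, continuous function, and put $A_i(s)=\int_0^s\alpha_i(X_r)\,dr$; assume $\lim_{s\to\infty}A_i(s)=\infty$. Thus each $A_i$ is continuous and strictly increasing. Define $\eta_i=\inf\{s: A_i(s)\ge Z_i\}$ for $i=0,\dots,K$, and the default times $\tau_i=\min(\eta_0,\eta_i)$ for $i=1,\dots,K$. Put $f_i(x)=\alpha_i(X_x)e^{-A_i(x)}$, the conditional density of $\eta_i$ given $\sigma(X_t: t\ge 0)$. $P_K$ is the set of all permutations of $(1,\dots,K)$; an element is written $j=(j_1,\dots,j_K)$. *)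

(* Defs.v *)
From HB Require Import structures.
From mathcomp Require Export all_boot all_order all_algebra perm.
From mathcomp Require Export all_classical all_reals all_analysis.
Export numFieldNormedType.Exports.

Set Implicit Arguments.
Unset Strict Implicit.
Unset Printing Implicit Defensive.

Import Order.TTheory GRing.Theory Num.Theory.

Local Open Scope classical_set_scope.
Local Open Scope ring_scope.

Section FilteredProbabilitySpace.
Context {dis : measure_display} {T : measurableType dis} {R : realType}.
Variable P : probability T R.

(* Time runs through [0, +oo[; the values of F and X at negative times are
   never constrained and never used. *)
Definition filtration (F : R -> set (set T)) : Prop :=
  (forall t, 0 <= t ->
     sigma_algebra [set: T] (F t) /\ F t `<=` measurable) /\
  (forall s t, 0 <= s -> s <= t -> F s `<=` F t).

Definition usual_conditions (F : R -> set (set T)) : Prop :=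
  [/\ measure_is_complete P,
      [set N | P.-negligible N] `<=` F 0 &
      forall t, 0 <= t -> F t = \bigcap_(s in [set s | t < s]) F s].

Definition mutually_independent (I : finType) (G : I -> set (set T)) : Prop :=
  forall (J : {set I}) (B : I -> set T), (forall i, i \in J -> G i (B i)) ->
    P (\bigcap_(i in [set i | i \in J]) B i) = (\prod_(i in J) P (B i))%E.

Context {E : ptopologicalType}.

Definition process (X : R -> T -> E) : Prop :=
  forall t, 0 <= t ->
    measurable_fun [set: T] (X t : T -> g_sigma_algebraType (@open E)).

Definition cadlag (x : R -> E) : Prop :=
  (forall t, 0 <= t -> x s @[s --> t^'+] --> x t) /\
  (forall t, 0 < t -> cvg (x s @[s --> t^'-])).

Definition sigma_process (X : R -> T -> E) : set (set T) :=
  <<s [set B | exists t U, [/\ 0 <= t, open U & B = X t @^-1` U]] >>.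

End FilteredProbabilitySpace.

(* int_{lo}^oo f_1(x_1) int_{x_1+eps}^oo f_2(x_2) ...
     int_{x_{n-1}+eps}^oo f_n(x_n) g(x_n+eps) dx_n ... dx_2 dx_1 *)
Fixpoint iterated_integral {R : realType} (eps : R) (fs : seq (R -> R))
    (g : R -> R) (lo : R) : \bar R :=
  match fs with
  | [::] => (g lo)%:E
  | f :: fs' =>
      (\int[lebesgue_measure]_(x in `[lo, +oo[)
         ((f x)%:E * iterated_integral eps fs' g (x + eps)))%E
  end.

Section DefaultTimes.
Context {T : Type} {R : realType} {E : Type} (K : nat).
Variables (alpha : 'I_K.+1 -> E -> R) (X : R -> T -> E) (Z : 'I_K.+1 -> T -> R).

Definition cumulative (i : 'I_K.+1) (w : T) (s : R) : R :=
  (\int[lebesgue_measure]_(r in `[0, s]) alpha i (X r w))%R.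

Definition eta (i : 'I_K.+1) (w : T) : R :=
  inf [set s | 0 <= s /\ Z i w <= cumulative i w s].

(* The names 1, ..., K are the elements of 'I_K, embedded in the index set
   {0, ..., K} = 'I_K.+1 by lift ord0 : i |-> i + 1. *)
Definition tau (i : 'I_K) (w : T) : R :=
  Num.min (eta ord0 w) (eta (lift ord0 i) w).

Definition density (i : 'I_K.+1) (w : T) (x : R) : R :=
  alpha i (X x w) * expR (- cumulative i w x).

(* The sequence j_1, ..., j_K. *)
Definition arrangement (j : {perm 'I_K}) : seq 'I_K.+1 :=
  [seq lift ord0 (j k) | k <- enum 'I_K].

Definition spaced_integral (eps : R) (j : {perm 'I_K}) (w : T) : \bar R :=
  iterated_integral eps
    [seq density i w | i <- take K.-1 (arrangement j)]
    (fun y => expR (- cumulative (last ord0 (arrangement j)) w y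
                    - cumulative ord0 w y))
    0.

End DefaultTimes.

(* Main.v *)
From HB Require Import structures.
From mathcomp Require Import measurable_realfun.
Require Import Defs.

Set Implicit Arguments.
Unset Strict Implicit.
Unset Printing Implicit Defensive.

Import Order.TTheory GRing.Theory Num.Theory.

Local Open Scope classical_set_scope.
Local Open Scope ring_scope.

(* The default times are pairwise at least eps apart exactly when they can be
   listed along a permutation with successive gaps at least eps, and then that
   permutation is unique. In such a list the common shock eta_0 can only affect
   the last name, so the event reads
     eta_{j_1} + eps <= eta_{j_2}, ..., eta_{j_{K-1}} + eps <= eta_{j_K}, eta_0.
   Its probability is computed by integrating out eta_0, eta_{j_K},
   eta_{j_{K-1}}, ... in turn, each exponential variable being independent of X
   and of the variables still to be integrated. No differentiation of A_i is
   needed: A_i carries the measure alpha_i(X_x) dx to Lebesgue measure, since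
   both give the mass A_i(t) to the times before t, so the substitution
   z = A_i(x) turns the exponential law of Z_i into the density f_i. *)

(** * Measures with a density and image measures *)

Section density.
Local Open Scope ereal_scope.
Context d (T : measurableType d) (R : realType).
Variable mu : {measure set T -> \bar R}.

(** Yields a bundled measure, to which uniqueness of measures can be applied; sigma-additivity is
    additivity of nonnegative integrals over disjoint unions. *)
Lemma exists_measure_density (f : T -> R) :
  measurable_fun [set: T] f -> (forall x, 0 <= f x)%R ->
  exists nu : {measure set T -> \bar R},
    forall A, nu A = \int[mu]_(x in A) (f x)%:E.
Proof.
move=> mf f0; pose nu A := \int[mu]_(x in A) (f x)%:E.
have nu0 : nu set0 = 0 by rewrite /nu integral_set0.
have nu_ge0 A : 0 <= nu A.
  by apply: integral_ge0 => x _; rewrite lee_fin.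
have nu_sigma : semi_sigma_additive nu.
  move=> F mF tF mUF; rewrite /nu ge0_integral_bigcup//.
  - by apply: is_cvg_ereal_nneg_natsum => n _; exact: nu_ge0.
  - exact/measurable_EFinP/measurable_funTS.
  - by move=> x _; rewrite lee_fin.
pose m : {measure set T -> \bar R} :=
  HB.pack nu (isMeasure.Build _ _ _ nu nu0 nu_ge0 nu_sigma).
by exists m.
Qed.

Import HBNNSimple.

(** Linearity reduces simple functions to indicators, where the claim is [nuE]; monotone convergence
    along a simple approximation of [h] does the rest. *)
Lemma ge0_integral_density (nu : {measure set T -> \bar R}) (f : T -> R)
    (h : T -> \bar R) :
  measurable_fun [set: T] f -> (forall x, 0 <= f x)%R ->
  (forall A, measurable A -> nu A = \int[mu]_(x in A) (f x)%:E) ->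
  measurable_fun [set: T] h -> (forall x, 0 <= h x) ->
  \int[nu]_x h x = \int[mu]_x (h x * (f x)%:E).
Proof.
move=> mf f0 nuE mh h0.
have mf' : measurable_fun [set: T] (EFin \o f) by exact/measurable_EFinP.
have simple (g : {nnsfun T >-> R}) :
    \int[nu]_x (g x)%:E = \int[mu]_x ((g x)%:E * (f x)%:E).
  have mg r : measurable (g @^-1` [set r]).
    by rewrite -[X in measurable X]setTI; exact: measurable_funP.
  rewrite integralT_nnsfun sintegralE.
  under [RHS]eq_integral => x _.
    rewrite fimfunE -fsumEFin// ge0_mule_fsuml//; last first.
      by move=> y; exact: nnfun_muleindic_ge0.
    over.
  rewrite ge0_integral_fsum//; last 2 first.
  - move=> y; apply: emeasurable_funM => //.
    exact/measurable_EFinP/measurable_funM.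
  - move=> y x _; rewrite mule_ge0 ?lee_fin// -lee_fin EFinM.
    exact: nnfun_muleindic_ge0.
  apply: eq_fsbigr => r /[!inE] -[t _ <-].
  under [RHS]eq_integral do rewrite EFinM -muleA.
  rewrite [RHS]ge0_integralZl//.
  - rewrite nuE//; congr (_ * _).
    rewrite [LHS]integral_mkcond; apply: eq_integral => x _.
    by rewrite epatch_indic muleC.
  - by apply: emeasurable_funM => //; exact/measurable_EFinP.
  - by move=> x _; rewrite mule_ge0// lee_fin.
  - by rewrite lee_fin.
pose g := nnsfun_approx measurableT mh.
have gh x : (g n x)%:E @[n --> \oo] --> h x by exact: cvg_nnsfun_approx.
have g_nd x : {homo (fun n => (g n x)%:E) : m n / (m <= n)%N >-> m <= n}.
  by move=> m n mn; rewrite lee_fin; exact/lefP/nd_nnsfun_approx.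
transitivity (\int[nu]_x limn (fun n => (g n x)%:E)).
  by apply: eq_integral => x _; apply/esym/cvg_lim => //; exact: gh.
transitivity (\int[mu]_x limn (fun n => (g n x)%:E * (f x)%:E)); last first.
  by apply: eq_integral => x _; apply/cvg_lim => //; exact: cvgeZr.
rewrite !monotone_convergence//.
- by congr (limn _); apply/funext => n; exact: simple.
- by move=> n; apply: emeasurable_funM => //; exact/measurable_EFinP.
- by move=> n x _; rewrite mule_ge0// lee_fin.
- by move=> x _ m n mn; rewrite lee_wpmul2r ?lee_fin//; exact: g_nd.
- by move=> n; exact/measurable_EFinP.
- by move=> n x _; rewrite lee_fin.
Qed.

End density.

Lemma exists_pushforward d1 d2 (T1 : measurableType d1) (T2 : measurableType d2)
    (R : realType) (m : {measure set T1 -> \bar R}) (f : T1 -> T2) :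
  measurable_fun [set: T1] f ->
  exists m' : {measure set T2 -> \bar R}, m' = pushforward m f :> (_ -> _).
Proof.
move=> mf.
pose m' : {measure set T2 -> \bar R} := pushforward m f.
by exists (m' mf).
Qed.

(** * Hazards and hitting times *)

Section hazard.
Context {R : realType}.
Notation mu := (@lebesgue_measure R).

Definition hazard (r : R -> R) (t : R) : R := (\int[mu]_(u in `[0, t]) r u)%R.

Definition hitting (r : R -> R) (z : R) : R :=
  inf [set s | 0 <= s /\ z <= hazard r s].

Variable r : R -> R.
Hypothesis mr : measurable_fun [set: R] r.
Hypothesis r_gt0 : forall u, 0 < r u.
Hypothesis r_infty : hazard r t @[t --> +oo] --> +oo.

Let r_ge0 u : (0 <= (r u)%:E)%E. Proof. by rewrite lee_fin ltW. Qed.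

Let mrE D : measurable D -> measurable_fun D (EFin \o r).
Proof. by move=> mD; apply/measurable_EFinP; exact: measurable_funTS. Qed.

(* [hazard r s] would be [fine +oo = 0] if [r] were not integrable on [[0, s]],
   so divergence of the hazard already contains local integrability. *)
Lemma hazard_integrable t : mu.-integrable `[0, t] (EFin \o r).
Proof.
have [s ts s_gt0] : exists2 s, t <= s & 1 <= hazard r s.
  apply: (pinfty_ex_ge (num_real t)); exact: (cvgry_ge r_infty 1).
apply/integrableP; split; first exact: mrE.
under eq_integral do rewrite /= ger0_norm ?(ltW (r_gt0 _))//.
apply: (@le_lt_trans _ _ (\int[mu]_(u in `[0%R, s]) (r u)%:E)%E).
  apply: ge0_subset_integral => //; first exact: mrE.
  by apply: subset_itvl; rewrite bnd_simp.
rewrite ltey; apply: contraTneq s_gt0 => h.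
by rewrite /hazard /Rintegral h/= ler10.
Qed.

Lemma hazardE t : (hazard r t)%:E = (\int[mu]_(u in `[0%R, t]) (r u)%:E)%E.
Proof. by rewrite fineK//; exact: integrable_fin_num (hazard_integrable t). Qed.

Lemma hazard0 : hazard r 0 = 0.
Proof. by rewrite /hazard set_itv1 Rintegral_set1. Qed.

Lemma hazard_ge0 t : 0 <= hazard r t.
Proof. by apply: Rintegral_ge0 => u _; exact/ltW. Qed.

(** A zero integral over []s, t]] would make [r] vanish there outside a null set; as [r] is
    positive, the whole interval would lie in that null set, against its length [t - s]. *)
Lemma hazard_lt s t : 0 <= s -> s < t -> hazard r s < hazard r t.
Proof.
move=> s0 st; rewrite -subr_gt0 /hazard Rintegral_itvB//; last 2 first.
- exact: hazard_integrable.
- by rewrite bnd_simp ltW.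
have sub : `]s, t] `<=` `[0, t]%classic by apply: subset_itv; rewrite bnd_simp.
have int : mu.-integrable `]s, t] (EFin \o r).
  by apply: integrableS (hazard_integrable t).
rewrite lt_def Rintegral_ge0 ?andbT; last by move=> u _; exact/ltW.
apply: contraPneq st => int0.
have : (\int[mu]_(x in `]s, t]) `|(EFin \o r) x|)%E = 0.
  under eq_integral do rewrite /= ger0_norm ?(ltW (r_gt0 _))//.
  by rewrite -[LHS]fineK -/(Rintegral _ _ _) ?int0//; exact: integrable_fin_num.
move=> /(ae_eq_integral_abs _ _ (measurable_int _ int)) [//|N [mN N0 sN]].
suff : (mu `]s, t] <= mu N)%E.
  rewrite N0 lebesgue_measure_itv/= lte_fin; case: ltP => // st.
  by rewrite -EFinD lee_fin subr_le0 leNgt st.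
apply: le_measure; rewrite ?inE// => u su; apply: sN => /= /(_ su)/eqP.
by rewrite eqe gt_eqF.
Qed.

Lemma hazard_le s t : 0 <= s -> 0 <= t -> (hazard r s <= hazard r t) = (s <= t).
Proof.
move=> s0 t0; case: (ltgtP s t) => [st|ts|->]; last by rewrite lexx.
  by rewrite ltW// hazard_lt.
by apply/negbTE; rewrite -ltNge hazard_lt.
Qed.

(** Divergence supplies a bound [b] with [z <= hazard r b], and the intermediate value theorem
    applies to the continuous integral on [[0, b]]. *)
Lemma hazard_surj z : 0 <= z -> exists2 x, 0 <= x & hazard r x = z.
Proof.
move=> z0; have [b b0 zb] : exists2 b, 0 <= b & z <= hazard r b.
  apply: (pinfty_ex_ge (num_real 0)); exact: (cvgry_ge r_infty z).
have := parameterized_integral_continuous b0 (hazard_integrable b).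
move=> /(@IVT _ _ _ _ z b0); rewrite /parameterized_integral.
rewrite -!/(hazard _ _) hazard0 min_l ?max_r ?hazard_ge0// z0 zb => /(_ isT).
by move=> [x /[!in_itv]/= /andP[x0 _]]; exists x.
Qed.

(** The maximum with 0 accounts for negative levels, which are reached at time 0 already. *)
Lemma hittingE x z : 0 <= x -> hazard r x = Num.max z 0 -> hitting r z = x.
Proof.
move=> x0 xz; have xS : [set s | 0 <= s /\ z <= hazard r s] x.
  by split => //; rewrite xz le_max lexx.
apply/eqP; rewrite eq_le; apply/andP; split.
  by apply: ge_inf => //; exists 0 => s [].
apply: lb_le_inf; first by exists x.
by move=> s [s0 zs]; rewrite -hazard_le// xz ge_max zs hazard_ge0.
Qed.

Lemma hitting_ge0 z : 0 <= hitting r z.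
Proof.
have [x x0 xz] : exists2 x, 0 <= x & hazard r x = Num.max z 0.
  by apply: hazard_surj; rewrite le_max lexx orbT.
by rewrite (hittingE x0 xz).
Qed.

Lemma le_hitting t z :
  0 <= t -> 0 <= z -> (t <= hitting r z) = (hazard r t <= z).
Proof.
move=> t0 z0; have [x x0 xz] := hazard_surj z0.
by rewrite (hittingE x0) ?max_l// -xz hazard_le.
Qed.

(** For negative [z] both sides are false: the hitting time is 0, while [hazard r t] is positive.
    Having the equivalence for every real [z] gives measurability of [hitting r] on the whole
    line. *)
Lemma lt_le_hitting t z : 0 < t -> (t <= hitting r z) = (hazard r t <= z).
Proof.
move=> t0; have [z0|z0] := leP 0 z; first by rewrite le_hitting// ltW.
rewrite (hittingE (lexx 0)) ?max_r ?hazard0//; last exact: ltW.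
by rewrite !leNgt t0 (lt_trans z0)// -hazard0 hazard_lt.
Qed.

Lemma measurable_hitting : measurable_fun [set: R] (hitting r).
Proof.
apply: (measurability (@RGenCInfty.G R)); first exact: RGenCInfty.measurableE.
move=> _ [_ [t ->] <-]; rewrite setTI.
have [t0|t0] := leP t 0.
  rewrite (_ : _ @^-1` _ = setT)//; apply/seteqP; split => // z _ /=.
  by rewrite in_itv/= andbT (le_trans t0)// hitting_ge0.
rewrite (_ : _ @^-1` _ = `[hazard r t, +oo[%classic)//.
by apply/seteqP; split => z /=; rewrite !in_itv/= !andbT lt_le_hitting.
Qed.

End hazard.

(** * Substitution along the hazard and the law of the hitting time *)

Section exponential_hitting.
Context {R : realType}.
Notation mu := (@lebesgue_measure R).
Variable r : R -> R.
Hypothesis mr : measurable_fun [set: R] r.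
Hypothesis r_gt0 : forall u, 0 < r u.
Hypothesis r_infty : hazard r t @[t --> +oo] --> +oo.

Lemma hazard_hitting z : 0 <= z -> hazard r (hitting r z) = z.
Proof.
move=> z0; have [x x0 xz] := hazard_surj mr r_gt0 r_infty z0.
by rewrite (hittingE mr r_gt0 r_infty x0) ?max_l.
Qed.

Lemma hazard_eq0 t : t <= 0 -> hazard r t = 0.
Proof.
rewrite le_eqVlt => /predU1P[->|t0]; first exact: hazard0.
by rewrite /hazard set_itv_ge ?Rintegral_set0// bnd_simp -ltNge.
Qed.

Lemma measurable_hazard : measurable_fun [set: R] (hazard r).
Proof.
apply: nondecreasing_measurable => // s t st.
have [s0|s0] := leP 0 s; first by rewrite hazard_le// (le_trans s0).
by rewrite hazard_eq0 ?hazard_ge0// ltW.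
Qed.

(** The two sides integrate [h] against [m1], the image under [hitting r] of Lebesgue measure on the
    nonnegative half-line, and against [m2], which has density [r] there. Both give mass
    [hazard r t] to the times before [t]. *)
Lemma ge0_integral_hitting (h : R -> \bar R) :
  measurable_fun [set: R] h -> (forall x, 0 <= h x)%E ->
  (\int[mu]_(z in `[0%R, +oo[) h (hitting r z) =
   \int[mu]_(x in `[0%R, +oo[) ((r x)%:E * h x))%E.
Proof.
move=> mh h0; pose D : set R := `[0, +oo[%classic.
have mD : measurable D by exact: measurable_itv.
have m1D : measurable_fun [set: R] (\1_D : R -> R) by exact: measurable_indic.
have D0 x : 0 <= (\1_D x : R) by rewrite indicE ler0n.
have [m0 m0E] := exists_measure_density mu m1D D0.
have mhit := measurable_hitting mr r_gt0 r_infty.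
pose f := r \_ D.
have mf : measurable_fun [set: R] f.
  by apply/(measurable_restrictT _ mD)/measurable_funTS.
have f0 x : 0 <= f x.
  by rewrite /f patchE; case: ifP => // _; exact: ltW.
have [m2 m2E] := exists_measure_density mu mf f0.
have [m1 m1E] := exists_pushforward
  (T1 := measurableTypeR R) (T2 := measurableTypeR R) m0 mhit.
have DE z : D z = (0 <= z) :> Prop by rewrite /D /= in_itv /= andbT.
have neg t : t <= 0 -> hitting r @^-1` `]-oo, t[ `&` D = set0.
  move=> t0; rewrite -subset0 => z [/=]; rewrite in_itv/= => zt _.
  by move: zt; rewrite ltNge (le_trans t0)//; exact: hitting_ge0.
have pos t : 0 < t ->
    hitting r @^-1` `]-oo, t[ `&` D = `[0, hazard r t[%classic.
  move=> t0; have lt z : 0 <= z -> (hitting r z < t) = (z < hazard r t).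
    by move=> z0; rewrite !ltNge le_hitting// ltW.
  apply/seteqP; split => z [/=]; rewrite DE !in_itv/=.
    by move=> zt z0; rewrite z0 -lt.
  by move=> /andP[z0 zt]; split=> //; rewrite lt.
have m1t t : m1 `]-oo, t[%classic = (hazard r t)%:E.
  have mpre : measurable (hitting r @^-1` `]-oo, t[).
    by rewrite -[X in measurable X]setTI; exact: mhit.
  rewrite m1E /pushforward m0E integral_indic// setIC.
  have [t0|t0] := leP t 0; first by rewrite neg// hazard_eq0// measure0.
  rewrite pos// [LHS](lebesgue_measure_itv `[0, hazard r t[)/= lte_fin.
  by rewrite -(hazard0 r) hazard_lt// hazard0 sube0.
have m2t t : m2 `]-oo, t[%classic = (hazard r t)%:E.
  transitivity (\int[mu]_(x in `]-oo, t[) ((EFin \o r) \_ D) x)%E.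
    by rewrite m2E restrict_EFin.
  rewrite -integral_mkcondr.
  have [t0|t0] := leP t 0.
    rewrite hazard_eq0// (_ : _ `&` _ = set0) ?integral_set0//.
    rewrite -subset0 => z [/=]; rewrite DE in_itv/= => zt z0.
    by move: zt; rewrite ltNge (le_trans t0).
  rewrite (_ : _ `&` _ = `[0, t[%classic).
    rewrite integral_itv_bndo_bndc ?hazardE//.
    exact/measurable_EFinP/measurable_funTS.
  by apply/seteqP; split => z /=; rewrite DE !in_itv/= andbC => /andP.
(* The open left half-lines generate the Borel sets, are closed under intersection, and exhaust the
   line with finite mass. *)
have m12 A : measurable A -> m1 A = m2 A.
  apply: (@measure_unique _ R (measurableTypeR R) (@RGenInftyO.G R)
    (fun n => `]-oo, n%:R[%classic)).
  - exact: RGenInftyO.measurableE.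
  - move=> _ _ [x ->] [y ->]; exists (Num.min x y).
    by apply/seteqP; split => z /=; rewrite !in_itv/= lt_min => /andP.
  - by move=> n; exists n%:R.
  - rewrite -subTset => x _; exists (Num.truncn x).+1 => //=.
    by rewrite in_itv/= truncnS_gt.
  - by move=> _ [t ->]; rewrite m1t m2t.
  - by move=> n; rewrite m1t ltry.
transitivity (\int[m1]_x h x)%E.
  rewrite m1E ge0_integral_pushforward//= preimage_setT.
  rewrite (ge0_integral_density (mu := mu) m1D D0)//=; last first.
    exact: measurableT_comp mhit.
  rewrite [LHS]integral_mkcond; apply: eq_integral => x _.
  by rewrite epatch_indic.
rewrite (ge0_integral_density (mu := mu) mf)//; last first.
  by move=> A mA; rewrite m12.
rewrite [RHS]integral_mkcond; apply: eq_integral => x _.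
by rewrite /f !patchE; case: ifP => _; rewrite ?mule0// muleC.
Qed.

Variable nu : {measure set R -> \bar R}.
Hypothesis nuE : forall A, measurable A -> nu A = exponential_prob (1 : R) A.

Lemma ge0_integral_exponential (h : R -> \bar R) :
  measurable_fun [set: R] h -> (forall x, 0 <= h x)%E ->
  (\int[nu]_z h z =
   \int[mu]_(z in `[0%R, +oo[) (h z * (expR (- z))%:E))%E.
Proof.
move=> mh h0; have mid : measurable_fun [set: R] (id : R -> measurableTypeR R).
  exact: measurable_id.
(* [nu] has to be moved to [measurableTypeR R], the domain of Lebesgue measure,
   because its display differs from that of [R]. *)
have [nu' nu'E] := exists_pushforward nu mid.
transitivity (\int[nu']_z h z)%E.
  by rewrite nu'E ge0_integral_pushforward.
rewrite (ge0_integral_density (mu := mu)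
  (measurable_exponential_pdf (1 : R)))//; last 2 first.
- by move=> x; exact: exponential_pdf_ge0.
- by move=> A mA; rewrite nu'E; exact: nuE.
rewrite [RHS]integral_mkcond; apply: eq_integral => x _.
rewrite /exponential_pdf !patchE; case: ifP => _; rewrite ?mule0//.
by rewrite mul1r mulN1r.
Qed.

(** For [0 <= z] the weight [expR (- z)] equals [expR (- hazard r (hitting r z))], a function of the
    hitting time, so the substitution rule absorbs it into [k]. *)
Lemma ge0_integral_exponential_hitting (h : R -> \bar R) :
  measurable_fun [set: R] h -> (forall x, 0 <= h x)%E ->
  (\int[nu]_z h (hitting r z) =
   \int[mu]_(x in `[0%R, +oo[) ((r x * expR (- hazard r x))%:E * h x))%E.
Proof.
move=> mh h0; have mhit := measurable_hitting mr r_gt0 r_infty.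
rewrite ge0_integral_exponential//; last exact: measurableT_comp mhit.
pose k x := (h x * (expR (- hazard r x))%:E)%E.
transitivity (\int[mu]_(z in `[0%R, +oo[) k (hitting r z))%E.
  apply: eq_integral => z; rewrite inE/= in_itv/= andbT => z0.
  by rewrite /k hazard_hitting.
rewrite ge0_integral_hitting.
- apply: eq_integral => x _; rewrite /k EFinM -muleA.
  by congr (_ * _)%E; exact: muleC.
- apply: emeasurable_funM => //; apply/measurable_EFinP.
  apply: measurableT_comp => //; apply: measurableT_comp => //.
  exact: measurable_hazard.
- by move=> x; rewrite mule_ge0// lee_fin expR_ge0.
Qed.

Lemma exponential_hitting_ge (t : R) : 0 <= t ->
  (\int[nu]_z (t <= hitting r z)%R%:R%:E =
   (expR (- hazard r t))%:E)%E.
Proof.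
move=> t0; have mhit := measurable_hitting mr r_gt0 r_infty.
rewrite ge0_integral_exponential//; last first.
  apply/measurable_EFinP.
  rewrite (_ : (fun z => _) = \1_(hitting r @^-1` `[t, +oo[)).
    by apply: measurable_indic; rewrite -[X in measurable X]setTI; exact: mhit.
  by apply/funext => z; rewrite indicE mem_setE unfold_in/= bnd_simp andbT.
(* The hitting event is the tail event [hazard r t <= z]; its mass comes from the primitive
   [- expR (- z)], which tends to 0 at infinity. *)
transitivity (\int[mu]_(z in `[hazard r t, +oo[) (exponential_pdf 1 z)%:E)%E.
  rewrite [LHS]integral_mkcond [RHS]integral_mkcond; apply: eq_integral => z _.
  rewrite !patchE !mem_setE !in_itv/= !andbT.
  have [z0|z0] := leP 0 z; last by rewrite leNgt (lt_le_trans z0)// hazard_ge0.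
  rewrite (le_hitting mr)// exponential_pdfE// mul1r mulN1r.
  by case: ifP; rewrite ?mul1e ?mul0e.
rewrite (@ge0_continuous_FTC2y _ _ (fun x => - expR (- 1 * x)) _ 0).
- by rewrite sub0e -EFinN opprK mulN1r.
- by move=> x _; exact: exponential_pdf_ge0.
- apply: (@continuous_subspaceW R^o _ _ [set` `[0, +oo[%R]).
    by apply: subset_itvr; rewrite bnd_simp hazard_ge0.
  exact: within_continuous_exponential_pdf.
- rewrite -oppr0; apply: cvgN; under eq_fun do rewrite mulN1r.
  exact: cvgr_expR.
- by move=> x _; exact: ex_derive.
- apply: cvgN; apply/cvg_at_right_filter.
  by apply: continuous_comp; [exact: mulrl_continuous|exact: continuous_expR].
- move=> z; rewrite in_itv/= andbT => z0; apply: derive1_exponential_pdf.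
  by rewrite in_itv/= andbT (le_lt_trans _ z0)// hazard_ge0.
Qed.

End exponential_hitting.

(** * Integrating out independent variables *)

Section independent_sequence.
Context d (T : measurableType d) (R : realType) (P : probability T R).
Context (I : eqType) (Z : I -> {RV P >-> R}) (mu : probability R R).

Definition joint_event (B : I -> set R) (s : seq I) : set T :=
  [set w | forall i, i \in s -> B i (Z i w)].

(** For a duplicate-free [s]: the variables [Z i] are i.i.d. of law [mu] and jointly independent of
    [W]. Shorter lists are covered by taking some [B i] to be the whole line, and the codomain of
    [W] is arbitrary so that variables can be adjoined to it. *)
Definition independent_iid d' (S : measurableType d') (W : T -> S)
    (s : seq I) : Prop :=
  forall (D : set S) (B : I -> set R),
    measurable D -> (forall i, measurable (B i)) ->
    P (W @^-1` D `&` joint_event B s) =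
      (P (W @^-1` D) * \prod_(i <- s) mu (B i))%E.

Lemma measurable_joint_event (B : I -> set R) (s : seq I) :
  (forall i, measurable (B i)) -> measurable (joint_event B s).
Proof.
move=> mB; elim: s => [|i s IHs].
  by rewrite (_ : joint_event _ _ = setT)//; apply/seteqP; split.
rewrite (_ : joint_event _ _ = Z i @^-1` B i `&` joint_event B s).
  by apply: measurableI => //; exact: measurable_funPTI.
apply/seteqP; split => w.
  by move=> BZ; split=> [|j js]; apply: BZ; rewrite inE ?eqxx ?js ?orbT.
by move=> [Bi BZ] j /[!inE] /predU1P[->//|]; exact: BZ.
Qed.

Context d' (S : measurableType d') (W : T -> S) (i : I) (s : seq I).
Hypotheses (mW : measurable_fun [set: T] W).
Hypotheses (indepW : independent_iid W (i :: s)) (si : i \notin s).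

Let WZ w := (W w, Z i w).

Let mWZ : measurable_fun [set: T] WZ.
Proof. exact: measurable_fun_pair. Qed.

Let indep_rectangle D E B :
  measurable D -> measurable E -> (forall j, measurable (B j)) ->
  P (WZ @^-1` (D `*` E) `&` joint_event B s) =
    (P (W @^-1` D) * (mu E * \prod_(j <- s) mu (B j)))%E.
Proof.
(* Since [i] does not occur in [s], overwriting the family at [i] leaves its values on [s]
   unchanged. *)
move=> mD mE mB; pose B' j := if j == i then E else B j.
have mB' j : measurable (B' j) by rewrite /B'; case: ifP.
have B's j : j \in s -> B' j = B j.
  by move=> js; rewrite /B' ifN//; apply: contraNneq si => <-.
transitivity (P (W @^-1` D `&` joint_event B' (i :: s))).
  congr (P _); apply/seteqP; split => w.
    move=> [[/= Dw Ew] Bw]; split => // j /[!inE] /predU1P[->|js].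
      by rewrite /B' eqxx.
    by rewrite B's//; exact: Bw.
  move=> [Dw Bw]; split; last first.
    by move=> j js; rewrite -B's//; apply: Bw; rewrite inE js orbT.
  by split => //; have := Bw i (mem_head _ _); rewrite /B' eqxx.
rewrite indepW// big_cons /B' eqxx; congr (_ * (_ * _))%E.
by apply: eq_big_seq => j js; rewrite -/(B' j) B's.
Qed.

Let indep1 D E : measurable D -> measurable E ->
  P (WZ @^-1` (D `*` E)) = (P (W @^-1` D) * mu E)%E.
Proof.
move=> mD mE; have := indep_rectangle mD mE (fun=> measurableT).
rewrite big1 => [|j _]; last exact: probability_setT.
by rewrite mule1 (_ : joint_event _ _ = setT) ?setIT//; apply/seteqP; split.
Qed.

(** By factorization on rectangles the joint law of [W] and [Z i] is the product of the law of [W]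
    with [mu]; Tonelli then integrates [Z i] out first. *)
Lemma ge0_expectation_independent (h : S * R -> \bar R) :
  measurable_fun [set: S * R] h -> (forall x, 0 <= h x)%E ->
  (\int[P]_w h (W w, Z i w) = \int[P]_w \int[mu]_z h (W w, z))%E.
Proof.
move=> mh h0.
pose W' : {mfun T >-> S} := HB.pack W (isMeasurableFun.Build _ _ _ _ W mW).
pose WZ' : {mfun T >-> (S * R)%type} :=
  HB.pack WZ (isMeasurableFun.Build _ _ _ _ WZ mWZ).
transitivity (\int[distribution P WZ']_x h x)%E.
  by rewrite (ge0_integral_distribution WZ').
transitivity (\int[(distribution P W' \x mu)%E]_x h x)%E.
  apply/esym; apply: eq_measure_integral => A mA _.
  exact: product_measure_unique.
rewrite fubini_tonelli1// /fubini_F.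
rewrite (ge0_integral_distribution W')//.
  by apply: measurable_fun_fubini_tonelli_F.
by move=> x; apply: integral_ge0.
Qed.

(** For fixed [B], both sides are finite measures in the set of values of the pair: the image of [P]
    restricted to the joint event, and a multiple of the law of the pair. They agree on rectangles,
    which generate the product sigma-algebra and are stable under intersection. *)
Lemma independent_iid_pair : independent_iid (fun w => (W w, Z i w)) s.
Proof.
move=> X B mX mB; have mC := measurable_joint_event s mB.
have mu_ge0 j : (0 <= mu (B j))%E by exact: measure_ge0.
have prod_fin : (\prod_(j <- s) mu (B j))%E \is a fin_num.
  elim: s => [|j t IHt]; first by rewrite big_nil.
  by rewrite big_cons fin_numM// fin_num_measure.
have prod_ge0 : 0 <= fine (\prod_(j <- s) mu (B j))%E.
  by rewrite fine_ge0// prode_ge0.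
have [m1 m1E] := exists_pushforward (mrestr P mC) mWZ.
have [m2 m2E] := exists_pushforward (mscale (NngNum prod_ge0) P) mWZ.
suff /(_ X mX) : forall A, measurable A -> m1 A = m2 A.
  by rewrite m1E m2E /pushforward/= /mrestr /mscale/= fineK// muleC => ->.
apply: (@measure_unique _ R (S * R)%type
  [set A `*` B | A in measurable & B in measurable]
  (fun=> [set: (S * R)%type])).
- exact: measurable_prod_measurableType.
- move=> _ _ [D1 mD1 [E1 mE1 <-]] [D2 mD2 [E2 mE2 <-]]; rewrite -setXI.
  exists (D1 `&` D2); first exact: measurableI.
  by exists (E1 `&` E2); first exact: measurableI.
- by move=> _; exists setT => //; exists setT => //; rewrite setXTT.
- by apply/seteqP; split => // x _; exists 0%N.
- move=> _ [D mD [E mE <-]].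
  rewrite m1E m2E /pushforward/= /mrestr /mscale/= indep_rectangle//.
  by rewrite indep1// fineK// muleA muleC.
- move=> _; rewrite m1E /pushforward/= /mrestr.
  by rewrite preimage_setT setTI (le_lt_trans (probability_le1 _ _)) ?ltry.
Qed.

End independent_sequence.

Lemma measurable_fun_natrb d (T : measurableType d) (R : realType)
    (b : T -> bool) :
  measurable_fun [set: T] b -> measurable_fun [set: T] (fun x => (b x)%:R : R).
Proof.
move=> mb; rewrite (_ : (fun x => _) = \1_(b @^-1` [set true])).
  by apply: measurable_indic; rewrite -[X in measurable X]setTI; exact: mb.
apply/funext => x; rewrite indicE; congr (nat_of_bool _)%:R.
by apply/idP/idP; rewrite inE.
Qed.

Lemma measurable_fun_comp2 d1 d2 d3 d4 (T1 : measurableType d1)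
    (T2 : measurableType d2) (T3 : measurableType d3) (T4 : measurableType d4)
    (F : T2 -> T3 -> T4) (f : T1 -> T2) (g : T1 -> T3) :
  measurable_fun [set: (T2 * T3)%type] (fun p => F p.1 p.2) ->
  measurable_fun [set: T1] f -> measurable_fun [set: T1] g ->
  measurable_fun [set: T1] (fun x => F (f x) (g x)).
Proof.
by move=> mF mf mg; exact: (measurableT_comp mF (measurable_fun_pair mf mg)).
Qed.

(** * Joint measurability when the rate depends on a random parameter *)

Section random_hazard.
Context {R : realType} d (S : measurableType d) (rate : S -> R -> R).
Notation leb := (@lebesgue_measure R).
Hypothesis mrate : measurable_fun [set: S * R] (fun p => rate p.1 p.2).
Hypothesis rate_gt0 : forall s u, 0 < rate s u.
Hypothesis rate_infty : forall s, hazard (rate s) t @[t --> +oo] --> +oo.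

Lemma measurable_rate s : measurable_fun [set: R] (rate s).
Proof. exact: (measurable_fun_comp2 mrate). Qed.

(** Putting the bounds of integration into an indicator makes the hazard a partial integral over the
    whole line, measurable by Tonelli. *)
Lemma measurable_fun_hazard :
  measurable_fun [set: S * R] (fun p => hazard (rate p.1) p.2).
Proof.
pose G (q : S * R * R) : \bar R :=
  (rate q.1.1 q.2 * (0 <= q.2 <= q.1.2)%R%:R)%:E.
have mG : measurable_fun [set: S * R * R] G.
  apply/measurable_EFinP; apply: measurable_funM.
    apply: (measurable_fun_comp2 mrate) => //.
    exact: measurableT_comp measurable_fst measurable_fst.
  apply: measurable_fun_natrb; apply: measurable_and.
    exact: measurable_fun_ler.
  apply: measurable_fun_ler => //.
  exact: measurableT_comp measurable_snd measurable_fst.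
have G0 q : (0 <= G q)%E by rewrite lee_fin mulr_ge0// ltW.
have := measurable_fun_fubini_tonelli_F
  (T2 := measurableTypeR R) (m2 := leb) G mG G0.
move=> /(measurableT_comp (fine_measurable measurableT)).
apply: eq_measurable_fun => -[s t] _ /=.
rewrite /hazard /Rintegral [in RHS]integral_mkcond; congr fine.
apply: eq_integral => u _; rewrite patchE mem_setE in_itv/= /G/=.
by case: ifP; rewrite ?mulr1 ?mulr0.
Qed.

Lemma measurable_fun_hitting :
  measurable_fun [set: S * R] (fun p => hitting (rate p.1) p.2).
Proof.
apply: (measurability (@RGenCInfty.G R)); first exact: RGenCInfty.measurableE.
move=> _ [_ [t ->] <-]; rewrite setTI.
have [t0|t0] := leP t 0.
  rewrite (_ : _ @^-1` _ = setT)//; apply/seteqP; split => // -[s z] _ /=.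
  rewrite in_itv/= andbT (le_trans t0)// hitting_ge0//; exact: measurable_rate.
rewrite (_ : _ @^-1` _ =
    (fun p : S * R => hazard (rate p.1) t <= p.2) @^-1` [set true]).
  have mle : measurable_fun [set: S * R]
      (fun p => hazard (rate p.1) t <= p.2).
    apply: measurable_fun_ler => //.
    exact: (measurable_fun_comp2 (F := fun s => hazard (rate s))
      measurable_fun_hazard).
  by rewrite -[X in measurable X]setTI; exact: mle.
apply/seteqP; split => -[s z] /=; rewrite in_itv/= andbT lt_le_hitting//.
- exact: measurable_rate.
- exact: measurable_rate.
Qed.

(** The density, given [s], of the time at which the hazard reaches an independent exponential
    level. *)
Definition hitting_density s x := rate s x * expR (- hazard (rate s) x).

Lemma hitting_density_ge0 s x : 0 <= hitting_density s x.
Proof. by rewrite mulr_ge0 ?expR_ge0// ltW. Qed.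

Lemma measurable_hitting_density :
  measurable_fun [set: S * R] (fun p => hitting_density p.1 p.2).
Proof.
apply: measurable_funM => //; apply: measurableT_comp => //.
by apply: measurableT_comp => //; exact: measurable_fun_hazard.
Qed.

End random_hazard.

(** * Hitting times with prescribed gaps *)

Section spaced_hittings.
Context d (T : measurableType d) (R : realType) (P : probability T R).
Context (I : eqType) (Z : I -> {RV P >-> R}) (mu : probability R R).
Hypothesis muE : forall A, measurable A -> mu A = exponential_prob (1 : R) A.
Context dS (S : measurableType dS) (V : T -> S) (rate : I -> S -> R -> R).
Notation leb := (@lebesgue_measure R).
Hypothesis mV : measurable_fun [set: T] V.
Hypothesis mrate : forall i,
  measurable_fun [set: (S * R)%type] (fun p => rate i p.1 p.2).
Hypothesis rate_gt0 : forall i s u, 0 < rate i s u.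
Hypothesis rate_infty : forall i s, hazard (rate i s) t @[t --> +oo] --> +oo.
Variables (eps : R) (l0 l : I).
Hypothesis eps_ge0 : 0 <= eps.

Let hit i s z := hitting (rate i s) z.

(** For [0 <= x], the conditional probability given [s] that neither [l] nor the common shock [l0]
    hits before [x]. *)
Definition survival (s : S) (x : R) : R :=
  expR (- hazard (rate l s) x - hazard (rate l0 s) x).

(** For [0 <= x], this is the conditional probability, given [s], of the event
    [spaced_hittings q x]. *)
Definition spaced_density (q : seq I) (s : S) (x : R) : \bar R :=
  iterated_integral eps [seq hitting_density (rate i) s | i <- q]
    (survival s) x.

(* [l] is the last name of the list, [l0] the common shock. *)
Fixpoint spaced_hittings (q : seq I) (lo : R) (w : T) : bool :=
  if q is i :: q' then
    (lo <= hit i (V w) (Z i w)) &&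
    spaced_hittings q' (hit i (V w) (Z i w) + eps) w
  else (lo <= hit l (V w) (Z l w)) && (lo <= hit l0 (V w) (Z l0 w)).

Lemma spaced_density_ge0 q s x : (0 <= spaced_density q s x)%E.
Proof.
elim: q x => [|i q IHq] x; first by rewrite lee_fin expR_ge0.
apply: integral_ge0 => u _; rewrite mule_ge0 ?lee_fin ?hitting_density_ge0//.
exact: IHq.
Qed.

(** With the lower bound turned into an indicator, the domain no longer varies with [x], so Tonelli
    gives joint measurability in [s] and [x]. *)
Lemma spaced_density_cons i q s x :
  spaced_density (i :: q) s x =
  (\int[leb]_u ((hitting_density (rate i) s u * (x <= u)%R%:R)%:E *
                spaced_density q s (u + eps)))%E.
Proof.
rewrite /spaced_density/= integral_mkcond; apply: eq_integral => u _.
rewrite patchE mem_setE in_itv/= andbT.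
by case: ifP; rewrite ?mulr1 ?mulr0 ?mul0e.
Qed.

Lemma measurable_spaced_density q :
  measurable_fun [set: (S * R)%type] (fun p => spaced_density q p.1 p.2).
Proof.
elim: q => [|i q IHq].
  apply/measurable_EFinP; apply: measurableT_comp => //.
  by apply: measurable_funB; [apply: measurableT_comp => //|];
    exact: measurable_fun_hazard.
pose G (p : S * R * R) : \bar R :=
  ((hitting_density (rate i) p.1.1 p.2 * (p.1.2 <= p.2)%R%:R)%:E *
   spaced_density q p.1.1 (p.2 + eps))%E.
have m11 : measurable_fun [set: (S * R * R)%type] (fun p => p.1.1).
  exact: measurableT_comp measurable_fst measurable_fst.
have mG : measurable_fun [set: (S * R * R)%type] G.
  apply: emeasurable_funM; last first.
    apply: (measurable_fun_comp2 (F := spaced_density q) IHq) => //.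
    exact: measurable_funD.
  apply/measurable_EFinP; apply: measurable_funM.
    exact: (measurable_fun_comp2 (measurable_hitting_density _ _)).
  apply: measurable_fun_natrb; apply: measurable_fun_ler => //.
  exact: measurableT_comp measurable_snd measurable_fst.
have G0 p : (0 <= G p)%E.
  rewrite mule_ge0 ?spaced_density_ge0// lee_fin mulr_ge0//.
  exact: hitting_density_ge0.
have := measurable_fun_fubini_tonelli_F
  (T2 := measurableTypeR R) (m2 := leb) G mG G0.
by apply: eq_measurable_fun => -[s t] _; rewrite /= spaced_density_cons.
Qed.

Let mu_hitting i s (h : R -> \bar R) :
  measurable_fun [set: R] h -> (forall x, 0 <= h x)%E ->
  (\int[mu]_z h (hit i s z) =
   \int[leb]_(x in `[0%R, +oo[) ((hitting_density (rate i) s x)%:E * h x))%E.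
Proof.
move=> mh h0.
exact: (ge0_integral_exponential_hitting (measurable_rate (mrate i) s)).
Qed.

Let mu_hitting_ge i s (t : R) : 0 <= t ->
  (\int[mu]_z (t <= hit i s z)%R%:R%:E = (expR (- hazard (rate i s) t))%:E)%E.
Proof.
move=> t0; exact: (exponential_hitting_ge (measurable_rate (mrate i) s)).
Qed.

Let mhit i d' (S' : measurableType d') (f : S' -> S) (g : S' -> R) :
  measurable_fun [set: S'] f -> measurable_fun [set: S'] g ->
  measurable_fun [set: S'] (fun x => hit i (f x) (g x)).
Proof.
move=> mf mg; apply: (measurable_fun_comp2 (F := hit i)) => //.
exact: measurable_fun_hitting.
Qed.

(* [W] is the information already fixed, from which [pr] recovers [V], and [D]
   the gap constraints already imposed on it; the induction moves [Z i] from the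
   independent variables into [W]. *)
Lemma probability_spaced_hittings q d' (S' : measurableType d') (W : T -> S')
    (pr : S' -> S) (lo : S' -> R) (D : set S') :
  measurable_fun [set: T] W -> measurable_fun [set: S'] pr ->
  measurable_fun [set: S'] lo -> measurable D ->
  (forall w, pr (W w) = V w) -> (forall s, 0 <= lo s) ->
  uniq (q ++ [:: l; l0]) -> independent_iid Z mu W (q ++ [:: l; l0]) ->
  P (W @^-1` D `&` [set w | spaced_hittings q (lo (W w)) w]) =
  (\int[P]_(w in W @^-1` D) spaced_density q (V w) (lo (W w)))%E.
Proof.
elim: q d' S' W pr lo D => [|i q IHq] d' S' W pr lo D mW mpr mlo mD prW lo0 /=.
- move=> uq indepW.
  pose h1 (x : S' * R) : \bar R :=
    (\1_D x.1 * (lo x.1 <= hit l (pr x.1) x.2)%R%:R)%:E.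
  pose b0 (y : S' * R * R) := lo y.1.1 <= hit l0 (pr y.1.1) y.2.
  pose h0 (y : S' * R * R) : \bar R := (h1 y.1 * (b0 y)%:R%:E)%E.
  pose e0 (s : S') : \bar R := (expR (- hazard (rate l0 (pr s)) (lo s)))%:E.
  have mh1 : measurable_fun [set: (S' * R)%type] h1.
    apply/measurable_EFinP; apply: measurable_funM.
      exact: measurableT_comp (measurable_indic mD) measurable_fst.
    apply: measurable_fun_natrb; apply: measurable_fun_ler.
      exact: measurableT_comp.
    by apply: mhit => //; exact: measurableT_comp.
  have m11 : measurable_fun [set: (S' * R * R)%type] (fun p => p.1.1).
    exact: measurableT_comp measurable_fst measurable_fst.
  have mb0 : measurable_fun [set: (S' * R * R)%type] b0.
    apply: measurable_fun_ler; first exact: measurableT_comp.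
    by apply: mhit => //; exact: measurableT_comp.
  have mh0 : measurable_fun [set: (S' * R * R)%type] h0.
    apply: emeasurable_funM; first exact: measurableT_comp.
    by apply/measurable_EFinP; exact: measurable_fun_natrb.
  have me0 : measurable_fun [set: S'] e0.
    apply/measurable_EFinP; apply: measurableT_comp => //.
    apply: measurableT_comp => //.
    apply: (measurable_fun_comp2 (F := fun s => hazard (rate l0 s))) => //.
    exact: measurable_fun_hazard.
  have h1_ge0 x : (0 <= h1 x)%E by rewrite lee_fin mulr_ge0.
  have h0_ge0 x : (0 <= h0 x)%E by rewrite mule_ge0// lee_fin.
  have e0_ge0 s : (0 <= e0 s)%E by rewrite lee_fin expR_ge0.
  have ll0 : l \notin [:: l0] by move: uq => /andP[].
  (* [Z l] joins the fixed information, so that [Z l0] can be integrated out first; [Z l] is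
     integrated out next, with [W] alone fixed. *)
  have indepWZ := independent_iid_pair mW indepW ll0.
  have mWZ : measurable_fun [set: T] (fun w => (W w, Z l w)).
    exact: measurable_fun_pair.
  transitivity (\int[P]_w h0 (W w, Z l w, Z l0 w))%E.
    pose A := [set w | D (W w) /\ (lo (W w) <= hit l (V w) (Z l w)) &&
                                 (lo (W w) <= hit l0 (V w) (Z l0 w))].
    have mloW : measurable_fun [set: T] (lo \o W) by exact: measurableT_comp.
    have mb : measurable_fun [set: T] (fun w =>
        (lo (W w) <= hit l (V w) (Z l w)) &&
        (lo (W w) <= hit l0 (V w) (Z l0 w))).
      by apply: measurable_and; apply: measurable_fun_ler => //; exact: mhit.
    have mA : measurable A.
      apply: measurableI; first by rewrite -[X in measurable X]setTI; exact: mW.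
      by rewrite -[X in measurable X]setTI; exact: mb.
    transitivity (\int[P]_w (\1_A w)%:E)%E.
      by rewrite integral_indic// setIT.
    apply: eq_integral => w _; rewrite /h0 /h1 /b0 /= prW -!EFinM !indicE.
    congr (_%:E); rewrite -!natrM !mulnb; congr (nat_of_bool _)%:R.
    apply/idP/idP => [/set_mem[Dw /andP[a b]]|/andP[/andP[/set_mem Dw a] b]].
      by rewrite mem_set// a b.
    by apply/mem_set; split; rewrite ?a.
  rewrite (ge0_expectation_independent mWZ indepWZ _ mh0 h0_ge0)//.
  transitivity (\int[P]_w (h1 (W w, Z l w) * e0 (W w)))%E.
    apply: eq_integral => w _; rewrite /h0/=.
    rewrite ge0_integralZl//; last first.
      apply/measurable_EFinP/measurable_fun_natrb; rewrite /b0/=.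
      by apply: measurable_fun_ler => //; exact: mhit.
    by rewrite /b0/= mu_hitting_ge.
  pose h2 (x : S' * R) := (h1 x * e0 x.1)%E.
  have mh2 : measurable_fun [set: (S' * R)%type] h2.
    by apply: emeasurable_funM => //; exact: measurableT_comp.
  have h2_ge0 x : (0 <= h2 x)%E by rewrite mule_ge0.
  rewrite (ge0_expectation_independent mW indepW ll0 mh2 h2_ge0).
  rewrite [RHS]integral_mkcond; apply: eq_integral => w _.
  have mbl : measurable_fun [set: R]
      (fun z => ((lo (W w) <= hit l (pr (W w)) z)%R%:R)%:E : \bar R).
    apply/measurable_EFinP; apply: measurable_fun_natrb.
    by apply: measurable_fun_ler => //; exact: mhit.
  rewrite /h2 /h1/=; under eq_integral do rewrite EFinM -muleA.
  rewrite ge0_integralZl//; last 2 first.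
  + by apply: emeasurable_funM.
  + by move=> z _; rewrite mule_ge0// lee_fin.
  rewrite ge0_integralZr// mu_hitting_ge// patchE indicE.
  rewrite /spaced_density/= /survival /e0 prW.
  have -> : (W w \in D) = (w \in W @^-1` D) by apply/idP/idP; rewrite !inE.
  by case: ifP => _; rewrite ?mul0e ?mul1e// -EFinM -expRD.
- move=> /andP[iq uq] indepW.
  (* The constraint on [i] is absorbed into the fixed event, and the next lower bound [lo'] becomes
     a function of the enlarged information. *)
  pose D' : set (S' * R) := [set x | D x.1 /\ lo x.1 <= hit i (pr x.1) x.2].
  pose lo' (x : S' * R) := hit i (pr x.1) x.2 + eps.
  pose WZ w := (W w, Z i w).
  have mWZ : measurable_fun [set: T] WZ by exact: measurable_fun_pair.
  have mh : measurable_fun [set: (S' * R)%type] (fun x => hit i (pr x.1) x.2).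
    by apply: mhit => //; exact: measurableT_comp.
  have mb : measurable_fun [set: (S' * R)%type]
      (fun x => lo x.1 <= hit i (pr x.1) x.2).
    by apply: measurable_fun_ler => //; exact: measurableT_comp.
  have mD' : measurable D'.
    apply: measurableI; rewrite -[X in measurable X]setTI; last exact: mb.
    exact: measurable_fst.
  have mlo' : measurable_fun [set: (S' * R)%type] lo' by exact: measurable_funD.
  transitivity (P (WZ @^-1` D' `&` [set w | spaced_hittings q (lo' (WZ w)) w])).
    congr (P _); apply/seteqP; split => w; rewrite /D' /lo' /WZ /= prW.
      by move=> [Dw /andP[low sp]].
    by move=> [[Dw low] sp]; split => //; rewrite low.
  rewrite (IHq _ _ WZ (pr \o fst) lo' D')//; last 3 first.
  - exact: measurableT_comp.
  - by move=> x; rewrite addr_ge0// hitting_ge0//; exact: measurable_rate.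
  - exact: (independent_iid_pair mW indepW).
  pose k (x : S' * R) : \bar R :=
    ((\1_D x.1)%:E * ((lo x.1 <= hit i (pr x.1) x.2)%R%:R%:E *
                      spaced_density q (pr x.1) (lo' x)))%E.
  have mk : measurable_fun [set: (S' * R)%type] k.
    apply: emeasurable_funM.
      apply/measurable_EFinP.
      exact: measurableT_comp (measurable_indic mD) measurable_fst.
    apply: emeasurable_funM; first exact/measurable_EFinP/measurable_fun_natrb.
    apply: (measurable_fun_comp2 (F := spaced_density q)) => //.
      exact: measurable_spaced_density.
    exact: measurableT_comp.
  have k_ge0 x : (0 <= k x)%E.
    by rewrite !mule_ge0 ?spaced_density_ge0// lee_fin.
  transitivity (\int[P]_w k (W w, Z i w))%E.
    rewrite integral_mkcond; apply: eq_integral => w _.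
    rewrite patchE /k/= prW indicE muleA -EFinM -natrM mulnb.
    have -> : (w \in WZ @^-1` D') =
        (W w \in D) && (lo (W w) <= hit i (V w) (Z i w)).
      apply/idP/idP => [/set_mem[Dw /=]|/andP[/set_mem Dw low]].
        by rewrite prW => ->; rewrite mem_set.
      by apply/mem_set; split; rewrite //= prW.
    by case: ifP => _; rewrite ?mul1e ?mul0e.
  rewrite (ge0_expectation_independent mW indepW iq mk k_ge0).
  rewrite [RHS]integral_mkcond; apply: eq_integral => w _.
  pose g y := ((lo (W w) <= y)%R%:R%:E * spaced_density q (V w) (y + eps))%E.
  have mg : measurable_fun [set: R] g.
    apply: emeasurable_funM.
      by apply/measurable_EFinP/measurable_fun_natrb; exact: measurable_fun_ler.
    apply: (measurable_fun_comp2 (F := spaced_density q)) => //.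
      exact: measurable_spaced_density.
    exact: measurable_funD.
  have g_ge0 y : (0 <= g y)%E.
    by rewrite mule_ge0 ?spaced_density_ge0// lee_fin.
  transitivity ((\1_D (W w))%:E * \int[mu]_z g (hit i (V w) z))%E.
    transitivity (\int[mu]_z ((\1_D (W w))%:E * g (hit i (V w) z)))%E.
      by apply: eq_integral => z _; rewrite /k /g /lo'/= prW.
    apply: ge0_integralZl => //.
    by apply: (measurableT_comp mg); exact: mhit.
  rewrite mu_hitting// patchE indicE.
  have -> : (W w \in D) = (w \in W @^-1` D) by apply/idP/idP; rewrite !inE.
  case: ifP => _; rewrite ?mul0e ?mul1e//.
  rewrite spaced_density_cons integral_mkcond; apply: eq_integral => u _.
  (* One integral is restricted to [0 <= u]; for negative [u] the indicator of [lo (W w) <= u]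
     vanishes in the other, since [lo] is nonnegative. *)
  rewrite patchE mem_setE in_itv/= andbT [in RHS]EFinM -muleA.
  case: ifPn => // u0; have -> : (lo (W w) <= u) = false.
    by apply/negbTE; apply: contra u0; exact: le_trans.
  by rewrite mul0e mule0.
Qed.

End spaced_hittings.

(** * Joint measurability of right-continuous processes *)

Lemma measurable_truncn_eq {R : realType} (c : R) (k : nat) :
  measurable [set x : R | Num.truncn (x * c) = k].
Proof.
have mle j : measurable [set x : R | (Num.truncn (x * c) <= j)%N].
  rewrite (_ : mkset _ = ( *%R^~ c) @^-1` `]-oo, j.+1%:R[).
    by rewrite -[X in measurable X]setTI; exact: mulrr_measurable.
  by apply/seteqP; split => x /=; rewrite truncn_le_nat in_itv.
case: k => [|k].
  rewrite (_ : mkset _ = [set x : R | (Num.truncn (x * c) <= 0)%N])//.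
  by apply/seteqP; split => x /=; rewrite leqn0 => /eqP.
rewrite (_ : mkset _ = [set x : R | (Num.truncn (x * c) <= k.+1)%N] `\`
                       [set x : R | (Num.truncn (x * c) <= k)%N]).
  exact: measurableD.
apply/seteqP; split => x /=; first by move=> ->; rewrite leqnn ltnn.
move=> [le_k /negP]; rewrite -ltnNge => lt_k.
by apply/eqP; rewrite eqn_leq le_k.
Qed.

(* [f s (max x 0)] is the limit of [f s] at the least multiple of [1 / (n + 1)]
   strictly above [max x 0] (note that [truncn] is [0] on negative numbers). *)
Lemma measurable_fun_right_continuous d (S : measurableType d) (R : realType)
    (f : S -> R -> R) :
  (forall t, 0 <= t -> measurable_fun [set: S] (f ^~ t)) ->
  (forall s t, 0 <= t -> f s u @[u --> t^'+] --> f s t) ->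
  measurable_fun [set: (S * R)%type] (fun p => f p.1 (Num.max p.2 0)).
Proof.
move=> mf cf.
pose grid (n : nat) (x : R) : R := (Num.truncn (x * n.+1%:R)).+1%:R / n.+1%:R.
have grid_gt (n : nat) (x : R) : Num.max x 0 < grid n x.
  rewrite /grid ltr_pdivlMr//; have [x0|x0] := leP x 0; first by rewrite mul0r.
  exact: truncnS_gt.
have grid_le (n : nat) (x : R) : grid n x <= Num.max x 0 + n.+1%:R^-1.
  rewrite /grid ler_pdivrMr// mulrDl mulVf// -natr1 lerD2r.
  have [x0|x0] := leP x 0; last by rewrite truncn_le// mulr_ge0// ltW.
  rewrite mul0r lern0 -leqn0 truncn_le_nat (le_lt_trans _ ltr01)//.
  by rewrite pmulr_lle0.
apply: (measurable_fun_cvg (h := fun n p => f p.1 (grid n p.2))).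
- move=> n _ Y mY; rewrite setTI.
  (* The grid point takes countably many values, so the preimage is a countable union of measurable
     rectangles. *)
  rewrite (_ : _ @^-1` Y = \bigcup_k ((f ^~ (k.+1%:R / n.+1%:R)) @^-1` Y `*`
      [set x | Num.truncn (x * n.+1%:R) = k])).
    apply: bigcupT_measurable => k; apply: measurableX; last first.
      exact: measurable_truncn_eq.
    have k0 : 0 <= k.+1%:R / n.+1%:R :> R by rewrite divr_ge0.
    by have := mf _ k0 measurableT _ mY; rewrite setTI.
  apply/seteqP; split => -[s x] /=; first by exists (Num.truncn (x * n.+1%:R)).
  by move=> [k _ [/= Yf xk]]; rewrite /grid xk.
- move=> [s x] _ /=.
  have : f s u @[u --> (Num.max x 0)^'+] --> f s (Num.max x 0).
    by apply: cf; rewrite le_max lexx orbT.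
  (* The sequential form of the right limit requires grid points strictly above the limit point,
     which [grid_gt] provides. *)
  move=> /cvg_at_rightP; apply; split => //.
  apply: (@squeeze_cvgr _ _ _ _ (cst (Num.max x 0))
    (fun n => Num.max x 0 + n.+1%:R^-1)).
  + by apply: nearW => n /=; rewrite grid_le andbT (ltW (grid_gt n x)).
  + exact: cvg_cst.
  + rewrite -[X in _ --> X]addr0; apply: cvgD; first exact: cvg_cst.
    exact: cvg_harmonic.
Qed.

(** * Separated points and permutations *)

Section gaps.
Context {R : realDomainType} (eps : R).
Hypothesis eps_gt0 : 0 < eps.

Definition gap : rel R := fun x y => x + eps <= y.

Lemma gap_trans : transitive gap.
Proof.
by move=> y x z xy; apply: le_trans; rewrite (le_trans xy)// lerDl ltW.
Qed.

Lemma gap_irr : irreflexive gap.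
Proof. by move=> x; rewrite /gap gerDl leNgt eps_gt0. Qed.

Context (K : nat) (t : 'I_K -> R).

Let gap_t : rel 'I_K := relpre t gap.

(** Sorting all names by time gives a duplicate-free list of length [K], that is, a permutation;
    ordered distinct names are at least [eps] apart by assumption. *)
Lemma perm_sorted_gap :
  (forall i j, i != j -> eps <= `|t i - t j|) ->
  exists j : {perm 'I_K}, sorted gap_t [seq j k | k <- enum 'I_K].
Proof.
move=> sep; pose s := sort (relpre t <=%R) (enum 'I_K).
have sK : size s == K by rewrite size_sort size_enum_ord.
have us : uniq s by rewrite sort_uniq enum_uniq.
have /tuple_uniqP tinj : uniq (Tuple sK) by [].
exists (perm tinj); rewrite (eq_map (permE tinj)) map_tnth_enum /=.
rewrite sorted_pairwise; last by move=> y x z; exact: gap_trans.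
have : pairwise (fun i j => (t i <= t j) && (i != j)) s.
  rewrite pairwise_relI -uniq_pairwise us andbT -sorted_pairwise.
    by apply: sort_sorted => i j; exact: le_total.
  by move=> y x z; exact: le_trans.
apply: sub_pairwise => i j /andP[tij ij]; have := sep i j ij.
by rewrite distrC ger0_norm ?subr_ge0// /gap_t/= /gap lerBrDl.
Qed.

(** Transitivity of [gap] carries the condition from neighbours to any two positions in the list. *)
Lemma sorted_gap_separated (s : seq 'I_K) :
  sorted gap_t s -> {in s &, forall i j, i != j -> eps <= `|t i - t j|}.
Proof.
move=> gs i j si sj.
have tr : transitive gap_t by move=> y x z; exact: gap_trans.
wlog ij : i j si sj / (index i s < index j s)%N => [hw|_].
  case: (ltngtP (index i s) (index j s)) => [|ji ne|/index_inj ->//].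
  - exact: hw.
  - by rewrite distrC; apply: hw => //; rewrite eq_sym.
  - by rewrite eqxx.
have := sorted_ltn_index tr gs i j si sj ij; rewrite /gap_t/= /gap => tij.
by rewrite distrC (le_trans _ (ler_norm _))// lerBrDl.
Qed.

(** A list sorted by a strict order is determined by its members, and both lists contain every
    name. *)
Lemma sorted_gap_inj (j j' : {perm 'I_K}) :
  sorted gap_t [seq j k | k <- enum 'I_K] ->
  sorted gap_t [seq j' k | k <- enum 'I_K] -> j = j'.
Proof.
move=> sj sj'; have memj (p : {perm 'I_K}) i : i \in [seq p k | k <- enum 'I_K].
  by apply/mapP; exists (p^-1%g i); rewrite ?mem_enum// permKV.
have /eq_in_map e : [seq j k | k <- enum 'I_K] = [seq j' k | k <- enum 'I_K].
  apply: (irr_sorted_eq (leT := gap_t)) => //.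
  - by move=> y x z; exact: gap_trans.
  - by move=> x; exact: gap_irr.
  - by move=> i; rewrite !memj.
by apply/permP => k; apply: e; rewrite mem_enum.
Qed.

End gaps.

Section spaced_hittings_path.
Context d (T : measurableType d) (R : realType) (P : probability T R).
Context (I : eqType) (Z : I -> {RV P >-> R}).
Context dS (S : measurableType dS) (V : T -> S) (rate : I -> S -> R -> R).
Variables (eps : R) (l0 l : I).
Hypothesis eps_gt0 : 0 < eps.

(* A name followed by another one in the list hits strictly before [l0] does,
   since the next minimum lies beyond the gap and below the time of [l0]; hence
   every minimum but the last is the hitting time of the name itself. *)
Lemma spaced_hittingsE q lo w :
  spaced_hittings Z V rate eps l0 l q lo w =
  path (gap eps) (lo - eps)
    [seq Num.min (hitting (rate l0 (V w)) (Z l0 w))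
                 (hitting (rate i (V w)) (Z i w)) | i <- rcons q l].
Proof.
set eta := fun i => hitting (rate i (V w)) (Z i w); rewrite -/(eta l0).
pose tau i := Num.min (eta l0) (eta i).
rewrite -[map _ _]/(map tau _).
have path_lt x q' : path (gap eps) x (map tau (rcons q' l)) -> x < eta l0.
  have gap_lt i : gap eps x (tau i) -> x < eta l0.
    rewrite /gap /tau le_min => /andP[+ _]; apply: lt_le_trans.
    by rewrite ltrDl.
  by case: q' => [|i q'] /= /andP[/gap_lt].
elim: q lo => [|i q IHq] lo /=.
  by rewrite andbT /gap subrK /tau le_min andbC.
rewrite IHq addrK /gap subrK -/(eta i) /tau.
apply/andP/andP => -[lo_le pth].
  have lt := path_lt _ _ pth.
  by rewrite min_r ?lo_le// ltW.
move: lo_le pth (path_lt _ _ pth).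
have [|_] := leP (eta i) (eta l0); first by move=> _ -> ->.
by rewrite ltxx.
Qed.

End spaced_hittings_path.

(** * Transfer to the given processes and the given independence *)

Lemma eq_iterated_integral (R : realType) (J : Type) (eps : R) (q : seq J)
    (f f' : J -> R -> R) (g : R -> R) (lo : R) :
  0 <= eps -> 0 <= lo -> (forall i x, 0 <= x -> f i x = f' i x) ->
  iterated_integral eps [seq f i | i <- q] g lo =
  iterated_integral eps [seq f' i | i <- q] g lo.
Proof.
move=> eps0 + ff'; elim: q lo => [//|i q IHq] lo lo0 /=.
apply: eq_integral => x; rewrite inE/= in_itv/= andbT => lox.
have x0 : 0 <= x by exact: le_trans lox.
by rewrite ff'// IHq// addr_ge0.
Qed.

Lemma measurable_spaced_hittings d (T : measurableType d) (R : realType)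
    (P : probability T R) (I : eqType) (Z : I -> {RV P >-> R})
    dS (S : measurableType dS) (V : T -> S) (rate : I -> S -> R -> R)
    eps l0 l q lo :
  measurable_fun [set: T] V ->
  (forall i, measurable_fun [set: (S * R)%type] (fun p => rate i p.1 p.2)) ->
  (forall i s u, 0 < rate i s u) ->
  (forall i s, hazard (rate i s) t @[t --> +oo] --> +oo) ->
  measurable_fun [set: T] lo ->
  measurable_fun [set: T]
    (fun w => spaced_hittings Z V rate eps l0 l q (lo w) w).
Proof.
move=> mV mrate rate_gt0 rate_infty.
have mhit i : measurable_fun [set: T] (fun w => hitting (rate i (V w)) (Z i w)).
  apply: (measurable_fun_comp2 (F := fun s => hitting (rate i s))) => //.
  exact: measurable_fun_hitting.
elim: q lo => [|i q IHq] lo mlo /=.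
  by apply: measurable_and; exact: measurable_fun_ler.
apply: measurable_and; first exact: measurable_fun_ler.
apply: (IHq (fun w => hitting (rate i (V w)) (Z i w) + eps)).
exact: measurable_funD.
Qed.

Lemma measurable_fun_preimage_open d (S : measurableType d) (R : realType)
    (E : topologicalType) (Y : S -> E) (a : E -> R) :
  (forall U, open U -> measurable (Y @^-1` U)) -> continuous a ->
  measurable_fun [set: S] (a \o Y).
Proof.
move=> mY ca; apply: (measurability (@RGenOInfty.G R)).
  exact: RGenOInfty.measurableE.
move=> _ [_ [t ->] <-]; rewrite setTI comp_preimage.
by apply: mY; move/continuousP : ca; apply; exact: interval_open.
Qed.

(** The product formula is read off at the index set made of [None], which stands for the
    sigma-algebra [H], and of [Some i] for [i] in [s]. *)
Lemma mutually_independent_iid d (T : measurableType d) (R : realType)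
    (P : probability T R) (I : finType) (Z : I -> {RV P >-> R})
    (mu : probability R R) (H : set (set T)) dS (S : measurableType dS)
    (V : T -> S) (s : seq I) :
  mutually_independent P (fun o : option I =>
    if o is Some i then g_sigma_algebra_preimage (Z i) else H) ->
  (forall D, measurable D -> H (V @^-1` D)) ->
  (forall i B, measurable B -> P (Z i @^-1` B) = mu B) ->
  uniq s -> independent_iid Z mu V s.
Proof.
move=> indep HV ZE us D B mD mB.
pose B' (o : option I) := if o is Some i then Z i @^-1` B i else V @^-1` D.
have := indep (None |: [set Some i | i in s])%SET B'.
rewrite big_setU1/=; last by apply/imsetP => -[].
rewrite big_imset/=; last by move=> i j _ _ [].
rewrite -big_uniq//= => indep_s.
rewrite -(eq_bigr _ (fun i _ => ZE i (B i) (mB i))) -indep_s.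
  congr (P _); apply/seteqP; split => w.
    move=> [Dw Bw] [i|] //= /setU1P[//|/imsetP[i' + [->]]].
    exact: Bw.
  move=> Bw; split; first exact: (Bw None (setU11 _ _)).
  move=> i si; apply: (Bw (Some i)) => /=.
  by rewrite inE; apply/orP; right; apply/imsetP; exists i; rewrite ?inE.
move=> [i|] _ /=; last exact: HV.
by exists (B i) => //; rewrite setTI.
Qed.

(** * Conditioning on the paths of [X] and summing over permutations *)

Theorem theorem6 (R : realType) (dis : measure_display) (T : measurableType dis)
    (P : probability T R) (F : R -> set (set T))
    (d K : nat) (X : R -> T -> 'rV[R]_d) (Z : 'I_K.+1 -> {RV P >-> R})
    (alpha : 'I_K.+1 -> 'rV[R]_d -> R) (eps : R)
    (filtrationF : filtration F) (usualF : usual_conditions P F)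
    (processX : process X) (cadlagX : forall w, cadlag (X ^~ w))
    (exponentialZ : forall i (B : set R), measurable B ->
       distribution P (Z i) B = exponential_prob (1 : R) B)
    (independentXZ : mutually_independent P
       (fun o : option 'I_K.+1 =>
          if o is Some i then g_sigma_algebra_preimage (Z i)
          else sigma_process X))
    (alpha_continuous : forall i, continuous (alpha i))
    (alpha_gt0 : forall i x, 0 < alpha i x)
    (cumulative_infty : forall i w,
       cumulative alpha X i w s @[s --> +oo] --> +oo)
    (K_ge2 : (2 <= K)%N) (eps_gt0 : 0 < eps) :
  P [set w | exists i j : 'I_K,
       i != j /\ `|tau alpha X Z i w - tau alpha X Z j w| < eps] =
  (1 - \int[P]_w \sum_(j : {perm 'I_K}) spaced_integral alpha X eps j w)%E.
Proof.
pose gens := [set B | exists t U, [/\ 0 <= t, open U & B = X t @^-1` U]].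
(* [S] is the sample space with the sigma-algebra generated by [X], so fixing the identity [V] into
   it amounts to conditioning on the paths. *)
pose S := g_sigma_algebraType gens.
(* Freezing the path at its time-0 value for negative [t] makes the rate jointly measurable on the
   whole line without changing the hazard. *)
pose rate i (w : S) t := alpha i (X (Num.max t 0) w).
have hazardE i w : hazard (rate i w) = cumulative alpha X i w.
  apply/funext => t; apply: eq_Rintegral => u.
  by rewrite inE/= in_itv/= => /andP[u0 _]; rewrite /rate max_l.
have etaE i w : hitting (rate i w) (Z i w) = eta alpha X Z i w.
  by rewrite /hitting hazardE.
pose V : T -> S := id.
have mV : measurable_fun [set: T] V.
  apply: (@measurability _ _ T S setT V gens erefl).
  move=> _ [_ [t [U [t0 oU ->]]] <-].
  by apply: processX => //; exact: sub_sigma_algebra.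
have mrate i : measurable_fun [set: (S * R)%type] (fun p => rate i p.1 p.2).
  apply: (@measurable_fun_right_continuous _ S R (fun w t => alpha i (X t w))).
    move=> t t0.
    apply: (@measurable_fun_preimage_open _ S R _ (X t)) => // U oU.
    by apply: sub_sigma_algebra; exists t, U.
  move=> w t t0; apply: (@continuous_cvg _ _ _ _ _ (X ^~ w)) => //.
    exact: alpha_continuous.
  exact: (cadlagX w).1.
have rate_gt0 i w u : 0 < rate i w u by exact: alpha_gt0.
have rate_infty i w : hazard (rate i w) t @[t --> +oo] --> +oo.
  by rewrite hazardE.
pose q (j : {perm 'I_K}) := take K.-1 (arrangement j).
pose l (j : {perm 'I_K}) := last ord0 (arrangement j).
have size_arr (j : {perm 'I_K}) : size (arrangement j) = K.-1.+1.
  by rewrite size_map size_enum_ord prednK//; exact: ltnW.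
have arrE (j : {perm 'I_K}) : rcons (q j) (l j) = arrangement j.
  rewrite /q /l; have := size_arr j.
  elim/last_ind: (arrangement j) => [//|s x _].
  rewrite size_rcons last_rcons => -[<-]; congr (rcons _ x).
  by rewrite -cats1 take_size_cat.
have uniq_arr (j : {perm 'I_K}) : uniq (q j ++ [:: l j; ord0]).
  rewrite -cat_rcons arrE cats1 rcons_uniq; apply/andP; split.
    by apply/mapP => -[k _] /eqP; rewrite (negbTE (neq_lift _ _)).
  by rewrite map_inj_uniq ?enum_uniq// => k k' /lift_inj /perm_inj.
have ZE i (B : set R) : measurable B ->
    P (Z i @^-1` B) = distribution P (Z ord0) B.
  by move=> mB; rewrite exponentialZ// -(exponentialZ i).
have iid (j : {perm 'I_K}) :
    independent_iid Z (distribution P (Z ord0)) V (q j ++ [:: l j; ord0]).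
  by apply: (mutually_independent_iid independentXZ).
pose spaced j w := spaced_hittings Z V rate eps ord0 (l j) (q j) 0 w.
have spacedE j w : spaced j w =
    sorted (relpre (fun i => tau alpha X Z i w) (gap eps))
      [seq j k | k <- enum 'I_K].
  rewrite /spaced spaced_hittingsE// arrE -sorted_map.
  rewrite [X in path _ _ X](_ : _ =
      [seq tau alpha X Z i w | i <- [seq j k | k <- enum 'I_K]]); last first.
    by rewrite /arrangement -!map_comp; apply: eq_map => k /=; rewrite !etaE.
  (* The path starts at [0 - eps], so its first condition says only that the first default time is
     nonnegative. *)
  case: [seq j k | k <- enum 'I_K] => [//|i s] /=.
  have eta_ge0 i' : 0 <= eta alpha X Z i' w.
    rewrite -etaE; apply: hitting_ge0 => //.
    exact: (measurable_rate (mrate i')).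
  by rewrite /gap subrK /tau le_min !eta_ge0.
have mspaced j : measurable_fun [set: T] (spaced j).
  exact: measurable_spaced_hittings.
pose dens j w := spaced_density rate eps ord0 (l j) (q j) (V w) 0.
have densE j w : spaced_integral alpha X eps j w = dens j w.
  rewrite /spaced_integral /dens /spaced_density.
  rewrite (_ : survival _ _ _ _ = fun y => expR (- cumulative alpha X (l j) w y
      - cumulative alpha X ord0 w y)); last by rewrite /survival !hazardE.
  apply: (@eq_iterated_integral _ _ _ _ (fun i => density alpha X i w)) => //.
    exact: ltW.
  move=> i x x0.
  by rewrite /hitting_density hazardE /rate max_l.
have mdens j : measurable_fun [set: T] (dens j).
  apply: (measurable_fun_comp2
    (F := spaced_density rate eps ord0 (l j) (q j))) => //.
  exact: measurable_spaced_density.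
have P_spaced j : (\int[P]_w (spaced j w)%:R%:E = \int[P]_w dens j w)%E.
  have mj : measurable [set w | spaced j w].
    by rewrite -[X in measurable X]setTI; exact: mspaced.
  transitivity (P [set w | spaced j w]).
    rewrite -[X in P X]setIT -integral_indic//; apply: eq_integral => w _.
    rewrite indicE; congr (nat_of_bool _)%:R%:E.
    by apply/idP/idP; rewrite inE.
  have := @probability_spaced_hittings _ T R P _ Z (distribution P (Z ord0)) _
    _ S V rate mV mrate rate_gt0 rate_infty eps ord0 (l j) _ (q j) _ S V id
    (cst 0) setT mV.
  rewrite preimage_setT setTI; apply => //; [exact: exponentialZ|exact: ltW].
pose G := [set w | exists j, spaced j w].
have mG : measurable G.
  rewrite (_ : G = \big[setU/set0]_(j : {perm 'I_K}) [set w | spaced j w]).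
    apply: bigsetU_measurable => j _.
    by rewrite -[X in measurable X]setTI; exact: mspaced.
  rewrite -bigcup_seq; apply/seteqP; split => w.
    by move=> [j sjw]; exists j => //=; rewrite mem_index_enum.
  by move=> [j _ sjw]; exists j.
(* [G] is the event that all default times are pairwise at least [eps] apart. *)
transitivity (P (~` G)).
  congr (P _); apply/seteqP; split => w /=.
    move=> [i [i' [ne]]]; rewrite ltNge => /negP ni [j]; rewrite spacedE => sj.
    apply: ni; apply: (sorted_gap_separated eps_gt0 sj) => //.
    + by apply/mapP; exists (j^-1%g i); rewrite ?mem_enum// permKV.
    + by apply/mapP; exists (j^-1%g i'); rewrite ?mem_enum// permKV.
  move=> nG; apply: contrapT => sep; apply: nG.
  have [|j sj] := perm_sorted_gap eps_gt0 (t := fun i => tau alpha X Z i w).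
    move=> i i' ne; rewrite leNgt; apply/negP => lt; apply: sep.
    by exists i, i'.
  by exists j; rewrite spacedE.
rewrite probability_setC//; congr (1 - _)%E.
under [RHS]eq_integral do under eq_bigr do rewrite densE.
rewrite ge0_integral_sum//; last first.
  by move=> j w _; exact: spaced_density_ge0.
(* At most one permutation lists the defaults with the required gaps, so the indicator of [G] is the
   sum of the indicators of the events [spaced j]. *)
transitivity (\int[P]_w \sum_(j : {perm 'I_K}) (spaced j w)%:R%:E)%E.
  rewrite -[X in P X]setIT -integral_indic//; apply: eq_integral => w _.
  rewrite indicE; have [[j sj]|nG] := pselect (G w).
    rewrite mem_set; last by exists j.
    rewrite (bigD1 j)//= sj big1 ?adde0// => j' ne.
    case sj' : (spaced j' w) => //; move: ne; rewrite spacedE in sj.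
    rewrite spacedE in sj'.
    by rewrite (sorted_gap_inj eps_gt0 sj' sj) eqxx.
  rewrite memNset// big1// => j _.
  by case sj : (spaced j w) => //; exfalso; apply: nG; exists j.
rewrite ge0_integral_sum//.
- by apply: eq_bigr => j _; exact: P_spaced.
- by move=> j; exact/measurable_EFinP/measurable_fun_natrb.
Qed.
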